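(* The set of Padua points $\mathrm{Pad}_n$ is unisolvent for $\Pi_n^2$. Furthermore, there is a cubature formula of degree $2n-1$ with respect to the weight $W$ on $[-1,1]^2$ based on the Padua points in $\mathrm{Pad}_n$; that is, there are numbers $\lambda_{\mathbf{x}}$, $\mathbf{x}\in\mathrm{Pad}_n$, such that $$\int_{[-1,1]^2} f(\mathbf{x})W(\mathbf{x})\,d\mathbf{x}=\sum_{\mathbf{x}\in\mathrm{Pad}_n}\lambda_{\mathbf{x}}f(\mathbf{x})\qquad\text{for all } f\in\Pi_{2n-1}^2 .$$
   Context: $\Pi_m^2$ is the space of real polynomials in two variables of total degree at most $m$; $\dim\Pi_n^2=(n+1)(n+2)/2$. A set $V$ of points in $\mathbb{R}^2$, assumed to have cardinality $|V|=\dim\Pi_n^2$, is said to be unisolvent for $\Pi_n^2$ if for any given function $f$ defined on $\mathbb{R}^2$ there is a unique polynomial $P\in\Pi_n^2$ such that $P(\mathbf{x})=f(\mathbf{x})$ for all $\mathbf{x}\in V$. $W$ is the Chebyshev weight function $$W(x_1,x_2)=\frac{1}{\pi^2}\frac{1}{\sqrt{1-x_1^2}\sqrt{1-x_2^2}},\qquad -1<x_1,x_2<1.$$ For each $n\ge0$, the Padua points are defined by $$\mathrm{Pad}_n=\{\mathbf{x}_{k,j}=(\xi_k,\eta_j):\ 0\le k\le n,\ 1\le j\le \lfloor n/2\rfloor+1\},$$ where $\xi_k=\cos\frac{k\pi}{n}$, and $\eta_j=\cos\frac{(2j-1)\pi}{n+1}$ if $k$ is even, $\eta_j=\cos\frac{(2j-2)\pi}{n+1}$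 if $k$ is odd (so $\eta_j$ depends also on the parity of $k$).
   Formalization: When n and k are both odd, j runs up to ⌊n/2⌋+2 instead of ⌊n/2⌋+1; with the printed range Pad_n has too few points for odd n (two points for n = 1, where the dimension is 3). For n = 0, ξ_0 is taken to be 1. *)

(* Defs.v *)
From HB Require Import structures.
From mathcomp Require Import all_boot all_order all_algebra.
From mathcomp Require Import all_classical all_reals all_analysis.
(* The notations of mpoly clash with those of mathcomp-analysis. *)
From mathcomp Require mpoly.
Export (canonicals, coercions) mpoly.

Set Implicit Arguments.
Unset Strict Implicit.
Unset Printing Implicit Defensive.

Import Order.TTheory GRing.Theory Num.Theory.

Local Open Scope classical_set_scope.
Local Open Scope ring_scope.

Definition poly2 (R : realType) := mpoly.mpoly 2 R.

Definition peval (R : realType) (P : poly2 R) (x : R * R) : R :=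
  mpoly.meval (tnth [tuple x.1; x.2]) P.

(* Polynomials of total degree at most m.  Since msize is the total degree
   plus one, and 0 at the zero polynomial, this is {0} for m = -1. *)
Definition Pi2 (R : realType) (m : int) : set (poly2 R) :=
  [set P | (mpoly.msize P)%:Z <= m + 1].

Definition dimPi2 (n : nat) : nat := (n.+1 * n.+2) %/ 2.

Definition unisolvent (R : realType) (n : nat) (V : set (R * R)) : Prop :=
  (V #= `I_(dimPi2 n))%card /\
  forall f : R * R -> R,
    exists! P : poly2 R,
      Pi2 n%:Z P /\ (forall x, V x -> peval P x = f x).

(* For n = 0 only k = 0 occurs, and division by zero makes the argument 0. *)
Definition xi (R : realType) (n k : nat) : R := cos (k%:R * pi / n%:R).

Definition eta (R : realType) (n k j : nat) : R :=
  if odd k then cos ((2 * j%:R - 2) * pi / n.+1%:R)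
  else cos ((2 * j%:R - 1) * pi / n.+1%:R).

(* When n and k are both odd, j takes one more value than n./2 + 1: without
   it there would be only (n + 1)^2 / 2 points for odd n, fewer than the
   dimension (n + 1)(n + 2) / 2. *)
Definition eta_count (n k : nat) : nat := (n./2 + 1 + (odd n && odd k))%N.

Definition Pad (R : realType) (n : nat) : set (R * R) :=
  [set x | exists k j : nat,
    [/\ (k <= n)%N, (1 <= j <= eta_count n k)%N
      & x = (xi R n k, eta R n k j)]].

Arguments Pad R n : clear implicits.

(* The weight is defined on the open square; on its boundary, a null set,
   this expression is 0. *)
Definition W (R : realType) (x : R * R) : R :=
  (pi ^+ 2)^-1 * ((Num.sqrt (1 - x.1 ^+ 2))^-1 * (Num.sqrt (1 - x.2 ^+ 2))^-1).

Definition square (R : realType) : set (R * R) :=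
  `[-1, 1]%classic `*` `[-1, 1]%classic.

Arguments square R : clear implicits.

(* Main.v *)
Require Import Defs.
From mathcomp Require Import all_boot all_order all_algebra.
From mathcomp Require Import all_classical all_reals all_analysis.
From mathcomp Require Import measurable_realfun.
From mathcomp Require Import ring lra zify.

(** Let T_a be the Chebyshev polynomial of degree a, so T_a(cos t) = cos (a t).
The Padua points are the points (cos (k pi / n), cos (l pi / (n + 1))) with
0 <= k <= n, 0 <= l <= n + 1 and k + l odd: half of a product grid
([Pad_image]).  Everything follows from the discrete orthogonality of the
products T_a(x) T_b(y) on this half grid.

Weight the point (k, l) by twice the product of the trapezoidal weights of k
and l.  The condition k + l odd has indicator (1 - (-1)^k (-1)^l) / 2, and
(-1)^k cos (a k pi / n) = cos ((a + n) k pi / n).  Hence the weighted sum of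
T_a(x) T_b(y) over the Padua points is
  S_n(a) S_(n+1)(b) - S_n(a + n) S_(n+1)(b + n + 1),
where S_n(a) is the trapezoidal sum of cos (a t) on [0, pi].  As S_n(a)
vanishes for 0 < a < 2n, the only products of degree a + b <= 2n with a
nonzero sum are 1 and T_(2n)(x) ([pad_moment]).

Cubature: the integral of T_a(x) T_b(y) W is 1 for a = b = 0 and 0 otherwise
([cheb2_W_moment]), so integral and weighted sum agree when a + b <= 2n - 1,
and these products span the polynomials of degree at most 2n - 1 ([Pi2_ind]).

Unisolvence: by the formula for cos s cos t, a product of two basis
polynomials of degree at most n is a combination of four basis polynomials of
degree at most 2n.  The exceptional T_(2n)(x) arises only from the square of
T_n(x), so the Gram matrix of the basis on the Padua points is diagonal with
nonzero diagonal ([pad_gram]).  Therefore the evaluation matrix of the basis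
at the points has a right inverse, and it is square: the points and the basis
are each indexed by half of the same grid, a reflection exchanging each half
with its complement ([card_padI], [card_triI]). *)

Import Order.TTheory GRing.Theory Num.Theory.
Import numFieldNormedType.Exports.
Set Implicit Arguments.
Unset Strict Implicit.
Local Open Scope classical_set_scope.
Local Open Scope ring_scope.

(** * Chebyshev polynomials *)

(** The ring is arbitrary so that the same recursion gives both the real value
T_n(x) and the polynomials T_n('X_0), T_n('X_1). *)
Fixpoint cheb (A : comNzRingType) (x : A) (n : nat) : A :=
  match n with
  | 0 => 1
  | m.+1 => match m with 0 => x | k.+1 => 2 * x * cheb x m - cheb x k end
  end.

Lemma chebSS (A : comNzRingType) (x : A) n :
  cheb x n.+2 = 2 * x * cheb x n.+1 - cheb x n.
Proof. by []. Qed.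

Lemma nat_ind2 (P : nat -> Prop) :
  P 0 -> P 1 -> (forall n, P n -> P n.+1 -> P n.+2) -> forall n, P n.
Proof.
move=> P0 P1 PS n; suff [] : P n /\ P n.+1 by [].
by elim: n => [//|n [Pn PSn]]; split=> //; exact: PS.
Qed.

Lemma rmorph_cheb (A B : comNzRingType) (f : {rmorphism A -> B}) (x : A) n :
  f (cheb x n) = cheb (f x) n.
Proof.
elim/nat_ind2: n => [||n IH0 IH1]; rewrite ?rmorph1 //.
by rewrite !chebSS rmorphB !rmorphM rmorph_nat IH0 IH1.
Qed.

Lemma cheb_cos (R : realType) (t : R) n : cheb (cos t) n = cos (n%:R * t).
Proof.
elim/nat_ind2: n => [||n IH0 IH1]; rewrite ?mul0r ?cos0 ?mul1r //.
rewrite chebSS IH0 IH1.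
have -> : n.+2%:R * t = n.+1%:R * t + t by rewrite -natr1; ring.
have -> : cos (n%:R * t) = cos (n.+1%:R * t - t).
  by congr cos; rewrite -[in RHS]natr1; ring.
by rewrite cosB cosD; ring.
Qed.

(** One of the two truncated differences is 0 and the other is the distance of
a and c, so the right-hand side stays within cosines of natural frequency. *)
Lemma mul_cos_nat (R : realType) (a c : nat) (t : R) :
  cos (a%:R * t) * cos (c%:R * t) =
  2^-1 * (cos ((a + c)%N%:R * t) + cos ((a - c + (c - a))%N%:R * t)).
Proof.
wlog ca : a c / (c <= a)%N.
  move=> H; case/orP: (leq_total c a) => /H //.
  by rewrite mulrC addnC [(c - a + _)%N]addnC.
have -> : (a - c + (c - a) = a - c)%N by lia.
by rewrite natrB // natrD mulrDl mulrBl cosB cosD; field.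
Qed.

(** * Trapezoidal sums of cosines *)

(** The weights of the trapezoidal rule for the mean on [0, pi] with n cells.
For n = 0 there is only the node 0, which carries the whole weight. *)
Definition trap (R : realType) (n k : nat) : R :=
  if n is 0 then 1 else ((k < n)%N%:R + (0 < k)%N%:R) / (2 * n%:R).

Definition angle (R : realType) (n k : nat) : R := k%:R * (pi / n%:R).

Definition trap_cos (R : realType) (n a : nat) : R :=
  \sum_(k < n.+1) trap R n k * cos (a%:R * angle R n k).

(** Each interior node is an endpoint of two cells, which is where the
numerator of the weight comes from. *)
Lemma trap_sum (R : realType) n (f : nat -> R) :
  \sum_(k < n.+2) trap R n.+1 k * f k =
  (2 * n.+1%:R)^-1 * \sum_(k < n.+1) (f k + f k.+1).
Proof.
rewrite big_split /=.
under eq_bigr do rewrite /trap mulrAC mulrC [(_ + _) * f _]mulrDl.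
rewrite -mulr_sumr big_split /=; congr (_ * (_ + _)).
  rewrite big_ord_recr /= ltnn mul0r addr0.
  by apply: eq_bigr => i _; rewrite ltn_ord mul1r.
rewrite big_ord_recl /= mul0r add0r.
by apply: eq_bigr => i _; rewrite mul1r.
Qed.

Lemma trap_cos0 (R : realType) n : trap_cos R n 0 = 1.
Proof.
rewrite /trap_cos; under eq_bigr do rewrite mul0r cos0.
case: n => [|n]; first by rewrite big_ord1 mulr1.
rewrite (trap_sum n (fun=> 1)) sumr_const card_ord -mulr_natr.
by field; rewrite -?natr1; have := ler0n R n; lra.
Qed.

Lemma cos_natpi (R : realType) k : cos (k%:R * pi) = (-1) ^+ k :> R.
Proof.
elim: k => [|k IH]; first by rewrite mul0r cos0.
by rewrite -natr1 mulrDl mul1r cosD IH cospi sinpi exprS; ring.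
Qed.

Lemma sin_natpi (R : realType) k : sin (k%:R * pi) = 0 :> R.
Proof.
elim: k => [|k IH]; first by rewrite mul0r sin0.
by rewrite -natr1 mulrDl mul1r sinD IH sinpi; ring.
Qed.

(** Alternating signs amount to a shift of the frequency by n. *)
Lemma cos_shift_angle (R : realType) n a k : (k <= n)%N ->
  cos ((a + n)%N%:R * angle R n k) = (-1) ^+ k * cos (a%:R * angle R n k).
Proof.
rewrite /angle; case: n => [|n] kn.
  by move: kn; rewrite leqn0 => /eqP ->; rewrite !mul0r !mulr0 cos0 mulr1.
have -> : (a + n.+1)%:R * (k%:R * (pi / n.+1%:R)) =
  a%:R * (k%:R * (pi / n.+1%:R)) + k%:R * pi :> R.
  by rewrite natrD; field; rewrite -?natr1; have := ler0n R n; lra.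
by rewrite cosD cos_natpi sin_natpi; ring.
Qed.

Lemma trap_cos2n (R : realType) n : trap_cos R n (n + n) = 1.
Proof.
rewrite -(trap_cos0 R n); apply: eq_bigr => k _; congr (_ * _).
have kn : (k <= n)%N by rewrite -ltnS.
rewrite cos_shift_angle // -[X in X%:R]add0n cos_shift_angle //.
by rewrite mulrA -expr2 sqrr_sign mul1r.
Qed.

(** Multiplied by sin (a pi / 2n), which is nonzero in this range, the sum over
the cells telescopes to a multiple of sin (a pi) = 0. *)
Lemma trap_cos_eq0 (R : realType) n a : (0 < a < n + n)%N -> trap_cos R n a = 0.
Proof.
case: n => [|n] /andP[a0 an]; first by lia.
rewrite /trap_cos (trap_sum n (fun k => cos (a%:R * angle R n.+1 k))).
have nz : n.+1%:R != 0 :> R by rewrite pnatr_eq0.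
(* Half of the angle by which a t advances over one cell. *)
pose h : R := a%:R * (pi / n.+1%:R) / 2.
have sh : sin h != 0.
  rewrite gt_eqF // sin_gt0_pi //; apply/andP; split.
    by rewrite !divr_gt0 ?mulr_gt0 ?divr_gt0 ?pi_gt0 ?ltr0n.
  have -> : h = pi * (a%:R / (n.+1 + n.+1)%:R).
    by rewrite /h natrD; field; rewrite -?natr1; have := ler0n R n; lra.
  rewrite gtr_pMr ?pi_gt0 // ltr_pdivrMr ?ltr0n ?addnS // mul1r ltr_nat.
  by move: an; rewrite addnS.
suff -> : \sum_(k < n.+1) (cos (a%:R * angle R n.+1 k) +
    cos (a%:R * angle R n.+1 k.+1)) = 0 by rewrite mulr0.
apply: (mulfI sh); rewrite mulr0 mulr_sumr.
transitivity (\sum_(k < n.+1)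
   (cos h * sin (a%:R * angle R n.+1 k.+1) - cos h * sin (a%:R * angle R n.+1 k))).
  apply: eq_bigr => k _.
  (* The midpoint of the cell, about which its endpoints are symmetric. *)
  pose m := a%:R * angle R n.+1 k + h.
  have -> : a%:R * angle R n.+1 k = m - h by rewrite /m addrK.
  have -> : a%:R * angle R n.+1 k.+1 = m + h.
    rewrite /m /h /angle -[k.+1%:R]natr1; field.
    by rewrite -?natr1; have := ler0n R n; lra.
  by clearbody m; rewrite cosB cosD sinB sinD; ring.
rewrite -(big_mkord xpredT (fun k => cos h * sin (a%:R * angle R n.+1 k.+1) -
  cos h * sin (a%:R * angle R n.+1 k))) telescope_sumr // /angle mul0r mulr0 sin0.
have -> : a%:R * (n.+1%:R * (pi / n.+1%:R)) = a%:R * pi :> R by field.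
by rewrite sin_natpi; ring.
Qed.

(** * The Padua points as half of a product grid *)

Definition grid (n : nat) : finType := ('I_n.+1 * 'I_n.+2)%type.

Definition padI (n : nat) : {set grid n} := [set i : grid n | odd (i.1 + i.2)].

(** The exponents of the basis T_a(x) T_b(y) of degree at most n, seen in the
same grid as the points so that the two cardinals can be compared. *)
Definition triI (n : nat) : {set grid n} := [set i : grid n | (i.1 + i.2 <= n)%N].

(** The set and its complement inject into each other, hence have the same
cardinal. *)
Lemma card_complementing (T : finType) (A : {set T}) (f : T -> T) :
  injective f -> (forall x, (f x \in A) = (x \notin A)) -> (#|A| = #|T| %/ 2)%N.
Proof.
move=> injf fA.
have -> : #|T| = (#|A| * 2)%N.
  rewrite -(cardsC A) -(card_preimset A injf) muln2 -addnn; congr (_ + _)%N.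
  by apply: eq_card => x; rewrite !inE fA.
by rewrite mulnK.
Qed.

Lemma card_grid n : #|grid n| = (n.+1 * n.+2)%N.
Proof. by rewrite card_prod !card_ord. Qed.

(** Reversing the coordinate whose largest index is odd (n or n + 1) changes the
parity of k + l. *)
Lemma card_padI n : #|padI n| = dimPi2 n.
Proof.
rewrite /dimPi2 -card_grid.
case: (boolP (odd n)) => on.
- pose f (i : grid n) : grid n := (rev_ord i.1, i.2).
  apply: (@card_complementing _ _ f) => [|[k l]].
    by apply: inv_inj => -[k l]; rewrite /f /= rev_ordK.
  by rewrite !inE /= subSS !oddD oddB -1?ltnS // on addTb addNb.
- pose f (i : grid n) : grid n := (i.1, rev_ord i.2).
  apply: (@card_complementing _ _ f) => [|[k l]].
    by apply: inv_inj => -[k l]; rewrite /f /= rev_ordK.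
  by rewrite !inE /= subSS !oddD oddB -1?ltnS //= (negbTE on) addTb addbN.
Qed.

(** Reversing both coordinates replaces a + b by 2n + 1 - (a + b). *)
Lemma card_triI n : #|triI n| = dimPi2 n.
Proof.
rewrite /dimPi2 -card_grid.
pose f (i : grid n) : grid n := (rev_ord i.1, rev_ord i.2).
apply: (@card_complementing _ _ f) => [|[k l]].
  by apply: inv_inj => -[k l]; rewrite /f /= !rev_ordK.
rewrite !inE /= !subSS.
by have := ltn_ord k; have := ltn_ord l; lia.
Qed.

Definition pad_weight (R : realType) n (i : grid n) : R :=
  2 * trap R n i.1 * trap R n.+1 i.2.

Definition pad_pt (R : realType) n (i : grid n) : R * R :=
  (cos (angle R n i.1), cos (angle R n.+1 i.2)).

(** Discrete orthogonality.  The second summand in the split of the sum would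
need a >= n and b >= n + 1, which a + b <= 2n forbids. *)
Lemma pad_moment (R : realType) n a b : (a + b <= n + n)%N ->
  \sum_(i in padI n) pad_weight R i *
    (cos (a%:R * angle R n i.1) * cos (b%:R * angle R n.+1 i.2)) =
  (((a == 0) || (a == n + n)) && (b == 0))%:R.
Proof.
move=> ab.
transitivity (trap_cos R n a * trap_cos R n.+1 b
  - trap_cos R n (a + n) * trap_cos R n.+1 (b + n.+1)).
  rewrite /trap_cos !big_distrlr /= -sumrB.
  under [RHS]eq_bigr do rewrite -sumrB.
  rewrite pair_bigA /= big_mkcond /=; apply: eq_bigr => -[k l] _ /=.
  rewrite !cos_shift_angle -1?ltnS // inE /= /pad_weight.
  rewrite -signr_odd -[(-1) ^+ l]signr_odd oddD.
  by case: (odd k); case: (odd l) => /=; rewrite ?expr0 ?expr1; ring.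
have [b0|b0] := posnP b; last first.
  rewrite [trap_cos _ n.+1 b]trap_cos_eq0; last by lia.
  have [an|an] := ltnP a n.
    by rewrite [trap_cos _ n (a + n)]trap_cos_eq0;
      [rewrite andbF mulr0 mul0r subr0|lia].
  by rewrite [trap_cos _ n.+1 _]trap_cos_eq0; [rewrite andbF !mulr0 subr0|lia].
rewrite b0 andbT [trap_cos _ n.+1 (0 + _)]trap_cos_eq0; last by lia.
rewrite mulr0 subr0 trap_cos0 mulr1.
have [->|a0] := posnP a; first by rewrite trap_cos0.
have [->|an] /= := eqVneq a (n + n)%N; first by rewrite trap_cos2n.
by rewrite trap_cos_eq0 //; lia.
Qed.

Definition cheb2 (R : realType) (p : nat * nat) (x : R * R) : R :=
  cheb x.1 p.1 * cheb x.2 p.2.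

Lemma cheb2_pad_pt (R : realType) n a b (i : grid n) :
  cheb2 (a, b) (pad_pt R i) =
  cos (a%:R * angle R n i.1) * cos (b%:R * angle R n.+1 i.2).
Proof. by rewrite /cheb2 /= !cheb_cos. Qed.

(** The Gram matrix of the basis on the Padua points is diagonal.  Its entries
on the diagonal depend on (a, b): the alias T_(2n)(x) of 1 enters exactly for
(a, b) = (n, 0). *)
Lemma pad_gram (R : realType) n a b c d : (a + b <= n)%N -> (c + d <= n)%N ->
  exists2 g : R, g != 0 &
  \sum_(i in padI n) pad_weight R i *
    (cheb2 (a, b) (pad_pt R i) * cheb2 (c, d) (pad_pt R i)) =
  g * ((a, b) == (c, d))%:R.
Proof.
move=> ab cd.
pose m p q : R := (((p == 0) || (p == n + n)) && (q == 0))%N%:R.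
have -> : \sum_(i in padI n) pad_weight R i *
    (cheb2 (a, b) (pad_pt R i) * cheb2 (c, d) (pad_pt R i)) =
  4^-1 * (m (a + c)%N (b + d)%N + m (a + c)%N (b - d + (d - b))%N +
    m (a - c + (c - a))%N (b + d)%N +
    m (a - c + (c - a))%N (b - d + (d - b))%N).
  rewrite /m -!pad_moment; [|lia..].
  rewrite -!big_split /= mulr_sumr; apply: eq_bigr => i _.
  by rewrite !cheb2_pad_pt [X in _ * X = _]mulrACA !mul_cos_nat; field.
rewrite /m xpair_eqE.
(* Different degrees in x: a + c < 2n, so every alias is excluded. *)
have [->|ac] := eqVneq a c; last first.
  exists 1; first exact: oner_neq0.
  rewrite mulr0.
  have -> : (a - c + (c - a) == 0)%N = false by lia.
  have -> : (a - c + (c - a) == n + n)%N = false by lia.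
  have -> : (a + c == 0)%N = false by lia.
  have [//|] := eqVneq (a + c)%N (n + n)%N; first by lia.
  by rewrite /= !addr0 mulr0.
(* Different degrees in y: both b + d and |b - d| are positive. *)
have [->|bd] := eqVneq b d; last first.
  exists 1; first exact: oner_neq0.
  have -> : (b - d + (d - b) == 0)%N = false by lia.
  have -> : (b + d == 0)%N = false by lia.
  by rewrite !andbF !addr0 !mulr0.
rewrite !subnn.
eexists; last by rewrite mulr1; reflexivity.
rewrite /= mulf_neq0 // gt_eqF // ltr_pwDr // !addr_ge0 // ler0n.
Qed.

Lemma cos_angle_inj (R : realType) n k l : (k <= n)%N -> (l <= n)%N ->
  cos (angle R n k) = cos (angle R n l) -> k = l.
Proof.
case: n => [|n] kn ln; first by lia.
have itv m : (m <= n.+1)%N -> angle R n.+1 m \in `[0, pi].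
  move=> mn; rewrite in_itv /= /angle mulrCA; apply/andP; split.
    by rewrite mulr_ge0 ?pi_ge0 // divr_ge0.
  by rewrite ger_pMr ?pi_gt0 // ler_pdivrMr ?ltr0n // mul1r ler_nat.
move=> /(cos_inj (itv _ kn) (itv _ ln)) /mulIf H.
apply/eqP; rewrite -(eqr_nat R); apply/eqP/H.
by rewrite mulf_neq0 ?invr_eq0 ?pnatr_eq0 ?gt_eqF ?pi_gt0.
Qed.

Lemma pad_pt_inj (R : realType) n : injective (@pad_pt R n).
Proof.
move=> [k l] [k' l'] [] /cos_angle_inj e1 /cos_angle_inj e2.
by congr (_, _); apply: val_inj; [apply: e1|apply: e2]; rewrite /= -ltnS.
Qed.

(** The index j of the definition enumerates the l of the right parity:
l = 2j - 1 for k even, l = 2j - 2 for k odd. *)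
Lemma Pad_image (R : realType) n : Pad R n = @pad_pt R n @` [set` padI n].
Proof.
apply/seteqP; split=> [x|_ [[k l] /=] /[!inE] /= okl <-].
- case=> k [j [kn jn ->]].
  pose l := if odd k then (2 * j - 2)%N else (2 * j - 1)%N.
  have ln : (l < n.+2)%N.
    move: jn; rewrite /l /eta_count; case: (odd k); have := odd_double_half n;
      case: (odd n) => /=; lia.
  exists (Ordinal (kn : (k < n.+1)%N), Ordinal ln) => /=.
    rewrite inE /= /l oddD; case: ifP jn => ok jn /=.
      by rewrite oddB ?oddM //; lia.
    by rewrite oddB ?oddM //; lia.
  rewrite /pad_pt /xi /eta /angle /l /=; congr (_, _); first by rewrite mulrA.
  by case: ifP jn => ok jn; rewrite natrB ?natrM ?mulrA //; lia.
- exists k, (l.+2./2).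
  have kn := ltn_ord k; have ln := ltn_ord l.
  have jl : (l.+2./2 = l./2.+1) by [].
  move: okl; rewrite oddD => okl.
  have lE := odd_double_half l; have nE := odd_double_half n.
  split; first by rewrite -ltnS.
    rewrite jl /eta_count.
    by move: okl lE nE; case: (odd k); case: (odd l) => //=;
      case: (odd n) => /= _; lia.
  rewrite /pad_pt /xi /eta /angle /=; congr (_, _); first by rewrite mulrA.
  move: okl lE; case: (odd k); case: (odd l) => //= _ lE.
    have -> : (l : nat)%:R = 2 * l./2.+1%:R - 2 :> R.
      by rewrite -natrM -natrB; [congr _%:R; lia|lia].
    by rewrite mulrA.
  have -> : (l : nat)%:R = 2 * l./2.+1%:R - 1 :> R.
      by rewrite -natrM -[1]/(1%:R) -natrB; [congr _%:R; lia|lia].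
  by rewrite mulrA.
Qed.

(** * Polynomials of bounded degree in the Chebyshev basis *)

Arguments cheb : simpl never.

Definition pvar (R : realType) (i : 'I_2) : poly2 R :=
  mpoly.mpolyX R (mpoly.mnm1 i).

Definition pcheb2 (R : realType) (p : nat * nat) : poly2 R :=
  cheb (pvar R 0) p.1 * cheb (pvar R 1) p.2.

Lemma pevalD (R : realType) (P Q : poly2 R) x :
  peval (P + Q) x = peval P x + peval Q x.
Proof. exact: mpoly.mevalD. Qed.

Lemma pevalZ (R : realType) c (P : poly2 R) x : peval (c *: P) x = c * peval P x.
Proof. exact: mpoly.mevalZ. Qed.

Lemma peval_sum (R : realType) (I : Type) (r : seq I) (F : I -> poly2 R) x :
  peval (\sum_(i <- r) F i) x = \sum_(i <- r) peval (F i) x.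
Proof. exact: raddf_sum. Qed.

Lemma peval_cheb2 (R : realType) p (x : R * R) : peval (pcheb2 R p) x = cheb2 p x.
Proof.
rewrite /peval mpoly.mevalM !rmorph_cheb.
by congr (cheb _ _ * cheb _ _); rewrite -[LHS]/(mpoly.meval _ _) mpoly.mevalXU.
Qed.

Lemma Pi2P (R : realType) (n : nat) (P : poly2 R) :
  Pi2 n%:Z P <-> (mpoly.msize P <= n.+1)%N.
Proof. by rewrite /Pi2 /= -PoszD lez_nat addn1. Qed.

Lemma Pi2_0 (R : realType) (n : nat) : Pi2 n%:Z (0 : poly2 R).
Proof. by apply/Pi2P; rewrite mpoly.msize0. Qed.

Lemma Pi2D (R : realType) (n : nat) (P Q : poly2 R) :
  Pi2 n%:Z P -> Pi2 n%:Z Q -> Pi2 n%:Z (P + Q).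
Proof.
move=> /Pi2P Pn /Pi2P Qn; apply/Pi2P.
by apply: leq_trans (mpoly.mmeasureD_le _ _ _) _; rewrite geq_max Pn.
Qed.

Lemma Pi2Z (R : realType) (n : nat) c (P : poly2 R) :
  Pi2 n%:Z P -> Pi2 n%:Z (c *: P).
Proof.
move=> /Pi2P Pn; apply/Pi2P.
by apply: leq_trans (mpoly.msizeZ_le _ _) _.
Qed.

Lemma Pi2M (R : realType) (m n : nat) (P Q : poly2 R) :
  Pi2 m%:Z P -> Pi2 n%:Z Q -> Pi2 (m + n)%N%:Z (P * Q).
Proof.
move=> /Pi2P Pm /Pi2P Qn; apply/Pi2P.
have [->|P0] := eqVneq P 0; first by rewrite mul0r mpoly.msize0.
have [->|Q0] := eqVneq Q 0; first by rewrite mulr0 mpoly.msize0.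
rewrite mpoly.msizeM //; move: (mpoly.msize P) (mpoly.msize Q) Pm Qn => p q; lia.
Qed.

Lemma Pi2_le (R : realType) (m n : nat) (P : poly2 R) : (m <= n)%N ->
  Pi2 m%:Z P -> Pi2 n%:Z P.
Proof. by move=> mn /Pi2P Pm; apply/Pi2P; apply: leq_trans Pm _. Qed.

Lemma Pi2_cheb (R : realType) (i : 'I_2) n : Pi2 n%:Z (cheb (pvar R i) n).
Proof.
elim/nat_ind2: n => [||n IH0 IH1].
- by apply/Pi2P; rewrite mpoly.msize1.
- by apply/Pi2P; rewrite mpoly.msizeX mpoly.mdeg1.
- rewrite chebSS -scaleN1r; apply: Pi2D; last first.
    by apply: Pi2Z; apply: Pi2_le IH0; lia.
  rewrite -mulrA mulr_natl -scaler_nat; apply: Pi2Z; rewrite -add1n.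
  by apply: Pi2M IH1; apply/Pi2P; rewrite mpoly.msizeX mpoly.mdeg1.
Qed.

Lemma Pi2_cheb2 (R : realType) n p : (p.1 + p.2 <= n)%N -> Pi2 n%:Z (pcheb2 R p).
Proof. by move=> /Pi2_le; apply; apply: Pi2M; exact: Pi2_cheb. Qed.

(** For n = 0 the index n - 1 is replaced by 1, since T_(-1) = T_1. *)
Lemma mulr_cheb (A : comNzRingType) (x : A) n :
  x * cheb x n *+ 2 = cheb x n.+1 + cheb x (if n is m.+1 then m else 1).
Proof.
case: n => [|n]; first by rewrite /= mulr1 mulr2n.
by rewrite chebSS subrK -mulrA mulr_natl.
Qed.

(** The T_a(x) T_b(y) with a + b <= m span the polynomials of degree at most m.
Multiplication by a variable raises the degree in the Chebyshev basis by at
most one, so every monomial is reached from 1. *)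
Lemma Pi2_ind (R : realType) (m : nat) (K : poly2 R -> Prop) :
  K 0 -> (forall P Q, K P -> K Q -> K (P + Q)) ->
  (forall c P, K P -> K (c *: P)) ->
  (forall a b, (a + b <= m)%N -> K (pcheb2 R (a, b))) ->
  forall P, Pi2 m%:Z P -> K P.
Proof.
move=> K0 KD KZ KT.
have KH P : K (P *+ 2) -> K P.
  move=> /(KZ 2^-1); rewrite mulr2n scalerDr -scalerDl.
  by rewrite (_ : 2^-1 + 2^-1 = 1 :> R) ?scale1r //; field.
have KX j a b : (a + b + j <= m)%N -> K (pvar R 1 ^+ j * pcheb2 R (a, b)).
  elim: j a b => [|j IH] a b abj; first by rewrite mul1r; apply: KT; lia.
  apply: KH; rewrite exprSr -mulrA [pvar R 1 * _]mulrCA -2!mulrnAr mulr_cheb /=.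
  rewrite mulrDr mulrDr; apply: KD; apply: IH; first by lia.
  by case: b abj => [|b]; lia.
have KXY i j a b : (a + b + j + i <= m)%N ->
    K (pvar R 0 ^+ i * (pvar R 1 ^+ j * pcheb2 R (a, b))).
  elim: i a b => [|i IH] a b abj; first by rewrite mul1r; apply: KX; lia.
  apply: KH; rewrite exprSr -mulrA [pvar R 0 * _]mulrCA [pvar R 0 * _]mulrA.
  rewrite -2!mulrnAr -mulrnAl mulr_cheb /= mulrDl !mulrDr.
  apply: KD; apply: IH; first by lia.
  by case: a abj => [|a]; lia.
move=> P /Pi2P Pm; rewrite [P]mpoly.mpolyE big_seq.
elim/big_rec: _ => // mon Q /mpoly.msize_mdeg_lt mP KQ.
apply: KD => //; apply: KZ.
rewrite mpoly.mpolyXE_id !big_ord_recl big_ord0 mulr1.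
have := KXY (mon ord0) (mon (lift ord0 ord0)) 0 0.
rewrite /pcheb2 /= !mulr1.
have -> : 1%R = lift ord0 ord0 :> 'I_2 by exact: val_inj.
apply; move: mP; rewrite mpoly.mdegE !big_ord_recl big_ord0; lia.
Qed.

(** * Unisolvence *)

Definition deg2 n (i : grid n) : nat * nat := (i.1 : nat, i.2 : nat).

Definition pad_mx (R : realType) n : 'M[R]_(#|triI n|, #|padI n|) :=
  \matrix_(i, j) cheb2 (deg2 (enum_val i)) (pad_pt R (enum_val j)).

(** The right inverse is the weighted transpose divided by the diagonal Gram
matrix. *)
Lemma pad_mx_free (R : realType) n : row_free (pad_mx R n).
Proof.
have tri (i : 'I_#|triI n|) : ((enum_val i).1 + (enum_val i).2 <= n)%N.
  by have := enum_valP i; rewrite inE.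
have /fin_all_exists[g Hg] (i : 'I_#|triI n|) : exists g : R, g != 0 /\
    forall k : 'I_#|triI n|, \sum_(x in padI n) pad_weight R x *
    (cheb2 (deg2 (enum_val k)) (pad_pt R x) *
     cheb2 (deg2 (enum_val i)) (pad_pt R x)) = g * (k == i)%:R.
  have [g g0 Eg] := pad_gram R (tri i) (tri i).
  exists g; split=> // k.
  have [-> //|ki] := eqVneq k i; first by rewrite Eg !eqxx.
  have [h _ ->] := pad_gram R (tri k) (tri i).
  rewrite mulr0 xpair_eqE (_ : _ && _ = false) ?mulr0 //.
  apply: contra_neqF ki => /andP[/eqP e1 /eqP e2].
  apply: enum_val_inj.
  case: (enum_val k) (enum_val i) e1 e2 => [a b] [c d] /= e1 e2.
  by congr (_, _); exact: val_inj.
apply/row_freeP.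
exists (\matrix_(j, i) (pad_weight R (enum_val j) * pad_mx R n i j / g i)).
apply/matrixP => k i; rewrite !mxE.
have [gi0 Ei] := Hg i.
transitivity ((\sum_(j < #|padI n|) pad_weight R (enum_val (A := padI n) j) *
    (cheb2 (deg2 (enum_val k)) (pad_pt R (enum_val j)) *
     cheb2 (deg2 (enum_val i)) (pad_pt R (enum_val j)))) / g i).
  by rewrite mulr_suml; apply: eq_bigr => j _; rewrite !mxE; ring.
rewrite -(big_enum_val (fun x => pad_weight R x *
  (cheb2 (deg2 (enum_val k)) (pad_pt R x) *
   cheb2 (deg2 (enum_val i)) (pad_pt R x)))).
by rewrite Ei mulrAC divff // mul1r.
Qed.

Lemma pad_mx_full (R : realType) n : row_full (pad_mx R n).
Proof.
have := pad_mx_free R n; rewrite /row_free /row_full => /eqP ->.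
by rewrite card_triI card_padI.
Qed.

Definition cheb_comb (R : realType) n (c : 'rV[R]_#|triI n|) : poly2 R :=
  \sum_i c 0 i *: pcheb2 R (deg2 (enum_val i)).

Lemma Pi2_cheb_comb (R : realType) n (c : 'rV[R]_#|triI n|) :
  Pi2 n%:Z (cheb_comb c).
Proof.
rewrite /cheb_comb; elim/big_rec: _ => [|i P _ Pn]; first exact: Pi2_0.
apply: Pi2D => //; apply/Pi2Z/Pi2_cheb2.
by have := enum_valP i; rewrite inE.
Qed.

Lemma cheb_combP (R : realType) n (P : poly2 R) :
  Pi2 n%:Z P -> exists c : 'rV[R]_#|triI n|, P = cheb_comb c.
Proof.
move: P; apply: Pi2_ind.
- by exists 0; rewrite /cheb_comb big1 // => i _; rewrite mxE scale0r.
- move=> _ _ [c ->] [d ->]; exists (c + d).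
  by rewrite /cheb_comb -big_split; apply: eq_bigr => i _; rewrite mxE scalerDl.
- move=> a _ [c ->]; exists (a *: c).
  by rewrite /cheb_comb scaler_sumr; apply: eq_bigr => i _; rewrite mxE scalerA.
- move=> a b ab.
  pose i0 : grid n := (inord a, inord b).
  have i0n : i0 \in triI n by rewrite inE /= !inordK //; lia.
  exists (delta_mx 0 (enum_rank_in i0n i0)).
  rewrite /cheb_comb (bigD1 (enum_rank_in i0n i0)) //= mxE !eqxx scale1r.
  rewrite enum_rankK_in // /deg2 /= !inordK; [|lia..].
  by rewrite big1 ?addr0 // => i ii0; rewrite mxE (negbTE ii0) andbF scale0r.
Qed.

Lemma peval_cheb_comb (R : realType) n (c : 'rV[R]_#|triI n|) j :
  peval (cheb_comb c) (pad_pt R (enum_val j)) = (c *m pad_mx R n) 0 j.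
Proof.
rewrite peval_sum mxE; apply: eq_bigr => i _.
by rewrite pevalZ peval_cheb2 mxE.
Qed.

Lemma Pad_enum (R : realType) n :
  Pad R n = (fun j : 'I_#|padI n| => pad_pt R (enum_val j)) @` setT.
Proof.
rewrite Pad_image; apply/seteqP; split=> [_ [i ip <-]|_ [j _ <-]].
  by exists (enum_rank_in ip i) => //; rewrite enum_rankK_in.
by exists (enum_val j) => //; exact: enum_valP.
Qed.

Theorem Pad_unisolvent (R : realType) n : unisolvent n (Pad R n).
Proof.
split.
  rewrite Pad_enum -card_padI; apply: card_eq_trans (card_esym card_II).
  by apply: inj_card_eq => i j _ _ /pad_pt_inj /enum_val_inj.
move=> f; pose v := \row_(j < #|padI n|) f (pad_pt R (enum_val (A := padI n) j)).
have /submxP[c vE] := submx_full v (pad_mx_full R n).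
exists (cheb_comb c); split.
  split; first exact: Pi2_cheb_comb.
  by rewrite Pad_enum => _ [j _ <-]; rewrite peval_cheb_comb -vE mxE.
move=> P [/cheb_combP[d ->] Pf]; congr cheb_comb.
apply: (row_free_inj (pad_mx_free R n)); rewrite -vE.
apply/rowP => j; rewrite -peval_cheb_comb Pf ?mxE //.
by rewrite Pad_enum; exists j.
Qed.

(** * The integral against the arcsine weight *)

Section arcsine.
Context {R : realType}.
Notation mu := (@lebesgue_measure R).

Lemma derive1_cos : derive1 (@cos R) = (fun t => - sin t).
Proof. by apply/funext => t; rewrite derive1E derive_val. Qed.

Lemma continuous_arcsine (x : R) : -1 < x < 1 ->
  {for x, continuous (fun x : R => (Num.sqrt (1 - x ^+ 2))^-1)}.
Proof.
move=> /andP[x1 x2].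
have x0 : 0 < 1 - x ^+ 2 by nra.
apply: cvgV; first by rewrite gt_eqF // sqrtr_gt0.
apply: continuous_cvg; first exact: sqrt_continuous.
by apply: cvgB; [exact: cvg_cst|exact: exprn_continuous].
Qed.

Lemma measurable_arcsine (f : R -> R) : continuous f ->
  measurable_fun (`[-1, 1]%classic : set R) (fun x => f x / Num.sqrt (1 - x ^+ 2)).
Proof.
move=> cf; apply/measurable_fun_itv_bndo_bndcP/measurable_fun_itv_obnd_cbndP.
apply: open_continuous_measurable_fun; first exact: interval_open.
move=> x; rewrite inE /= in_itv /= => x1.
by apply: cvgM; [exact: cf|exact: continuous_arcsine].
Qed.

(** Away from the endpoints the weight is continuous, and x = cos t is a regular
change of variables. *)
Lemma integral_arcsine_trunc (f : R -> R) (e : R) : continuous f ->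
  0 < e -> e <= pi - e ->
  (\int[mu]_(x in `[cos (pi - e)%R, cos e]) (f x / Num.sqrt (1 - x ^+ 2))%:E =
   \int[mu]_(t in `[e, (pi - e)%R]) (f (cos t))%:E)%E.
Proof.
move=> cf e0 ee.
have itv0pi t : t \in `[e, pi - e] -> 0 < t < pi.
  by rewrite in_itv /= => /andP[et te]; have := pi_gt0 R; lra.
rewrite (@integration_by_substitution_decreasing _ cos
  (fun x => f x / Num.sqrt (1 - x ^+ 2))) //.
- apply: eq_integral => t; rewrite inE /= => /itv0pi /sin_gt0_pi st.
  rewrite derive1_cos; congr EFin.
  transitivity (f (cos t) / Num.sqrt (1 - cos t ^+ 2) * - - sin t); first by [].
  by rewrite -sin2cos2 sqrtr_sqr gtr0_norm // opprK divfK // gt_eqF.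
- move=> x y /itv0pi /andP[x1 x2] /itv0pi /andP[y1 y2] xy.
  by rewrite ltr_cos // in_itv /= !ltW.
- move=> x _; rewrite derive1_cos; apply: cvgN; exact: continuous_sin.
- rewrite derive1_cos; apply/cvg_ex; exists (- sin e); apply: cvg_at_right_filter.
  by apply: cvgN; exact: continuous_sin.
- rewrite derive1_cos; apply/cvg_ex; exists (- sin (pi - e)).
  apply: cvg_at_left_filter; apply: cvgN; exact: continuous_sin.
- split.
  + by move=> x _; exact: derivable_cos.
  + by apply: cvg_at_right_filter; exact: continuous_cos.
  + by apply: cvg_at_left_filter; exact: continuous_cos.
- apply: continuous_in_subspaceT => x; rewrite inE /= in_itv /= => /andP[x1 x2].
  apply: cvgM; [exact: cf|apply: continuous_arcsine].
  have pi0 := pi_gt0 R.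
  apply/andP; split.
    apply: lt_le_trans x1; rewrite -cospi ltr_cos ?in_itv /=; lra.
  apply: le_lt_trans x2 _; rewrite -cos0 ltr_cos ?in_itv /=; lra.
Qed.

(** Both sides are limits of truncated integrals by monotone convergence, which
is why f is nonnegative. *)
Lemma integral_arcsine (f : R -> R) : continuous f ->
  (forall x, -1 <= x <= 1 -> 0 <= f x) ->
  (\int[mu]_(x in `[(-1)%R, 1%R]) (f x / Num.sqrt (1 - x ^+ 2))%:E =
   \int[mu]_(t in `[0%R, pi]) (f (cos t))%:E)%E.
Proof.
move=> cf f0; pose e k : R := pi / k.+2%:R.
have pi0 := pi_gt0 R.
have e0 k : 0 < e k by rewrite divr_gt0 // ltr0n.
have eh k : e k <= pi / 2 by rewrite ler_pM2l // lef_pV2 ?posrE ?ltr0n // ler_nat.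
have ehl k : e k <= pi - e k by have := eh k; lra.
have ele k l : (k <= l)%N -> e l <= e k.
  by move=> kl; rewrite ler_pM2l // lef_pV2 ?posrE ?ltr0n // ler_nat.
have esmall (t : R) : 0 < t -> exists k, e k <= t.
  move=> t0; exists (Num.truncn (pi / t)); rewrite /e ler_pdivrMr ?ltr0n //.
  rewrite mulrC -ler_pdivrMr //; apply/ltW.
  by apply: lt_trans (truncnS_gt _) _; rewrite ltr_nat.
have emx k l : e (maxn k l) <= e k /\ e (maxn k l) <= e l.
  by split; apply: ele; rewrite ?leq_maxl ?leq_maxr.
have Ut : `]0%R, pi[%classic = \bigcup_k `[e k, pi - e k]%classic :> set R.
  apply/seteqP; split=> [t|t [k _]]; rewrite /= !in_itv /= => /andP[t1 t2].
    have [k tk] := esmall _ t1.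
    have [l tl] : exists k, e k <= pi - t by apply: esmall; lra.
    have [mk ml] := emx k l.
    by exists (maxn k l) => //=; rewrite in_itv /=; lra.
  by have := e0 k; lra.
have Ux : `](-1)%R, 1%R[%classic =
    \bigcup_k `[cos (pi - e k), cos (e k)]%classic :> set R.
  apply/seteqP; split=> [x|x [k _]]; rewrite /= !in_itv /= => /andP[x1 x2].
    have x12 : -1 <= x <= 1 by rewrite !ltW.
    have : acos x \in `]0%R, pi[%classic.
      by rewrite inE /= in_itv /= acos_gt0 ?acos_ltpi // ?x1 ?x2 ?ltW.
    rewrite Ut inE => -[k _]; rewrite /= in_itv /= => /andP[k1 k2]; exists k => //=.
    have k0 := e0 k; have kp := ehl k.
    have ex : x = cos (acos x) by rewrite acosK.
    rewrite in_itv /= ex !leNgt !ltr_cos ?in_itv /=; lra.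
  have k0 := e0 k; have kp := ehl k; apply/andP; split.
    apply: lt_le_trans x1; rewrite -cospi ltr_cos ?in_itv /=; lra.
  apply: le_lt_trans x2 _; rewrite -cos0 ltr_cos ?in_itv /=; lra.
have cfc : continuous (f \o cos).
  by move=> t; apply: continuous_comp; [exact: continuous_cos|exact: cf].
have mG := measurable_arcsine cf.
have mfc (A : set R) : measurable A -> measurable_fun A (f \o cos).
  by move=> mA; apply: measurable_funTS; exact: continuous_measurable_fun.
transitivity (\int[mu]_(x in `](-1)%R, 1%R[) (f x / Num.sqrt (1 - x ^+ 2))%:E)%E.
  rewrite -integral_itv_bndo_bndc -?integral_itv_obnd_cbnd //;
  by apply/measurable_EFinP; apply: measurable_funS mG => //;
     move=> x; rewrite /= !in_itv /=; lra.
transitivity (\int[mu]_(t in `]0%R, pi[) (f (cos t))%:E)%E; last first.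
  by rewrite -[RHS]integral_itv_bndo_bndc -?integral_itv_obnd_cbnd //;
     apply/measurable_EFinP; exact: mfc.
rewrite Ux Ut.
have cvx := @ge0_nondecreasing_set_cvg_integral _ (measurableTypeR R) R
  (fun k => `[cos (pi - e k), cos (e k)]%classic)
  (fun x => (f x / Num.sqrt (1 - x ^+ 2))%:E) mu.
have cvt := @ge0_nondecreasing_set_cvg_integral _ (measurableTypeR R) R
  (fun k => `[e k, pi - e k]%classic) (fun t => (f (cos t))%:E) mu.
rewrite -(cvg_lim _ (cvx _ _ _ _)) // -?(cvg_lim _ (cvt _ _ _ _)) //.
- by apply: congr_lim; apply/funext => k; exact: integral_arcsine_trunc.
- apply/nondecreasing_seqP => k; rewrite subsetEset => t; rewrite /= !in_itv /=.
  by have := ele k k.+1 (leqnSn k); lra.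
- by move=> k; apply/measurable_EFinP; exact: mfc.
- by move=> k t _; rewrite lee_fin f0 // cos_geN1 cos_le1.
- apply/nondecreasing_seqP => k; rewrite subsetEset => x; rewrite /= !in_itv /=.
  have := (ele k k.+1 (leqnSn k), e0 k, e0 k.+1, ehl k, ehl k.+1).
  move=> [[[[ek1 ek2] ek3] ek4] ek5] /andP[x1 x2]; apply/andP; split.
    by apply: le_trans x1; rewrite leNgt ltr_cos ?in_itv /=; lra.
  by apply: (le_trans x2); rewrite leNgt ltr_cos ?in_itv /=; lra.
- move=> k; apply/measurable_EFinP; apply: measurable_funS mG => // x.
  rewrite /= !in_itv /= => /andP[x1 x2]; apply/andP; split.
    exact: le_trans (cos_geN1 _) x1.
  exact: le_trans x2 (cos_le1 _).
- move=> k x; rewrite /= in_itv /= => /andP[x1 x2].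
  rewrite lee_fin divr_ge0 ?sqrtr_ge0 // f0 //; apply/andP; split.
    exact: le_trans (cos_geN1 _) x1.
  exact: le_trans x2 (cos_le1 _).
Qed.
End arcsine.

(** * Moments of the Chebyshev weight and cubature *)

(** Tonelli gives the integrability of a product function, and Fubini its
integral. *)
Lemma integrable_prod_meas d1 d2 (T1 : measurableType d1) (T2 : measurableType d2)
    (R : realType) (m1 : {sigma_finite_measure set T1 -> \bar R})
    (m2 : {sigma_finite_measure set T2 -> \bar R}) (f : T1 -> R) (g : T2 -> R) :
  m1.-integrable setT (EFin \o f) -> m2.-integrable setT (EFin \o g) ->
  (m1 \x m2)%E.-integrable setT (fun z => (f z.1 * g z.2)%:E) /\
  (\int[m1 \x m2]_z (f z.1 * g z.2)%:E =
   \int[m1]_x (f x)%:E * \int[m2]_y (g y)%:E)%E.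
Proof.
move=> If Ig.
have mf : measurable_fun setT f by apply/measurable_EFinP/(measurable_int m1).
have mg : measurable_fun setT g by apply/measurable_EFinP/(measurable_int m2).
have mfg : measurable_fun setT (fun z : T1 * T2 => (f z.1 * g z.2)%:E).
  by apply/measurable_EFinP/measurable_funM; exact: measurableT_comp.
have Ifg : (m1 \x m2)%E.-integrable setT (fun z => (f z.1 * g z.2)%:E).
  apply/(integrable12ltyP _ _ mfg).
  have gfin : (\int[m2]_y `|(g y)%:E|)%E \is a fin_num.
    by rewrite ge0_fin_numE ?integral_ge0 //; have /integrableP[] := Ig.
  pose c := fine (\int[m2]_y `|(g y)%:E|)%E.
  have c0 : 0 <= c by rewrite fine_ge0 // integral_ge0.
  rewrite (eq_integral (fun x => c%:E * `|(f x)%:E|)%E); last first.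
    move=> x _; rewrite fineK // muleC -ge0_integralZl //.
      by apply: eq_integral => y _; rewrite /= normrM EFinM.
    by apply/measurable_EFinP; exact: measurableT_comp.
  rewrite ge0_integralZl //.
    by have /integrableP[_ fy] := If; rewrite lte_mul_pinfty.
  by apply/measurable_EFinP; exact: measurableT_comp.
split=> //; rewrite -(integral12_prod_meas1 Ifg).
have gfin := integrable_fin_num measurableT Ig.
rewrite -[in RHS](fineK gfin) muleC -integralZl //.
by apply: eq_integral => x _; rewrite fineK // muleC -integralZl //.
Qed.

Section chebyshev_moments.
Context {R : realType}.
Notation mu := (@lebesgue_measure R).

Lemma continuous_cheb n : continuous (fun x : R => cheb x n).
Proof.
elim/nat_ind2: n => [||n IH0 IH1] x; [exact: cvg_cst|exact: cvg_id|].
apply: cvgB; last exact: IH0.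
by apply: cvgM; [apply: cvgM; [exact: cvg_cst|exact: cvg_id]|exact: IH1].
Qed.

Lemma integral_cos_nat a : (0 < a)%N ->
  (\int[mu]_(t in `[0%R, pi]) (1 + cos (a%:R * t))%:E = pi%:E)%E.
Proof.
move=> a0; have a0' : a%:R != 0 :> R by rewrite pnatr_eq0 -lt0n.
pose F (t : R) := t + a%:R^-1 * sin (a%:R * t).
have dF (t : R) : is_derive t 1 F (1 + cos (a%:R * t)).
  rewrite /F; apply: is_derive_eq.
  by rewrite /GRing.scale /=; field.
have cF : continuous F.
  by move=> t; apply/differentiable_continuous/derivable1_diffP.
rewrite (@continuous_FTC2 _ _ F) ?pi_gt0 //.
- by rewrite /F mulr0 sin0 sin_natpi !mulr0 !addr0 sube0.
- apply: continuous_in_subspaceT => t _; apply: cvgD; first exact: cvg_cst.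
  apply: continuous_comp; last exact: continuous_cos.
  by apply: cvgM; [exact: cvg_cst|exact: cvg_id].
- split=> //; first by apply: cvg_at_right_filter; exact: cF.
  by apply: cvg_at_left_filter; exact: cF.
- by move=> t _; rewrite derive1E derive_val.
Qed.

Lemma integral_pi_cst : (\int[mu]_(t in `[0%R, pi]) 1%:E = (@pi R)%:E)%E.
Proof.
rewrite integral_cst // mul1e; have := lebesgue_measure_itv `[0%R, (@pi R)].
by rewrite /= lte_fin pi_gt0 sube0.
Qed.

Definition cheb_arcsine (a : nat) (x : R) := cheb x a / Num.sqrt (1 - x ^+ 2).

(** T_a changes sign, but 1 + T_a and 1 do not: subtracting their integrals
gives both the integrability and the value. *)
Lemma cheb_arcsine_moment a :
  mu.-integrable `[(-1)%R, 1%R] (EFin \o cheb_arcsine a) /\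
    (\int[mu]_(x in `[(-1)%R, 1%R]) (cheb_arcsine a x)%:E =
   (pi * (a == 0)%:R)%:E)%E.
Proof.
have int_ge0 (f : R -> R) : continuous f ->
    (forall x, -1 <= x <= 1 -> 0 <= f x) ->
    (\int[mu]_(t in `[0%R, pi]) (f (cos t))%:E = pi%:E)%E ->
    mu.-integrable `[(-1)%R, 1%R]
      (EFin \o (fun x => f x / Num.sqrt (1 - x ^+ 2))) /\
    (\int[mu]_(x in `[(-1)%R, 1%R]) (f x / Num.sqrt (1 - x ^+ 2))%:E = pi%:E)%E.
  move=> cf f0 fpi; have fE := integral_arcsine cf f0; split; last by rewrite fE fpi.
  apply/integrableP; split.
    by apply/measurable_EFinP; exact: measurable_arcsine.
  rewrite [X in (X < _)%E](_ : _ = pi%:E) ?ltry // -fpi -fE.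
  apply: eq_integral => x; rewrite inE /= in_itv /= => x1.
  by rewrite ger0_norm // divr_ge0 ?sqrtr_ge0 // f0.
have [I0 E0] : mu.-integrable `[(-1)%R, 1%R] (EFin \o cheb_arcsine 0) /\
    (\int[mu]_(x in `[(-1)%R, 1%R]) (cheb_arcsine 0 x)%:E = pi%:E)%E.
  apply: (int_ge0 (fun=> 1)) => //; first by move=> x; exact: cvg_cst.
  exact: integral_pi_cst.
have [->|a0] := posnP a; first by rewrite mulr1.
pose g (x : R) : R := (1 + cheb x a) / Num.sqrt (1 - x ^+ 2).
have [I1 E1] : mu.-integrable `[(-1)%R, 1%R] (EFin \o g) /\
    (\int[mu]_(x in `[(-1)%R, 1%R]) (g x)%:E = pi%:E)%E.
  apply: int_ge0 => [x|x x1|].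
  - by apply: cvgD; [exact: cvg_cst|exact: continuous_cheb].
  - rewrite -[x]acosK // cheb_cos.
    by have := cos_geN1 (a%:R * acos x); lra.
  - rewrite -(integral_cos_nat a0); apply: eq_integral => t _.
    by rewrite cheb_cos.
have E x : (cheb_arcsine a x)%:E = ((g x)%:E - (cheb_arcsine 0 x)%:E)%E.
  rewrite -EFinB /g /cheb_arcsine; congr EFin.
  by rewrite -[cheb x 0]/(1 : R) -mulrBl; congr (_ / _); ring.
split.
  rewrite (_ : EFin \o _ = (EFin \o g) \- (EFin \o cheb_arcsine 0))%E.
    exact: integrableB.
  by apply/funext => x /=; exact: E.
under eq_integral do rewrite E.
rewrite integralB //; transitivity (pi%:E - pi%:E : \bar R)%E; first by rewrite E0 E1.
by rewrite -EFinB subrr mulr0.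
Qed.

Local Notation itv11 := (`[(-1)%R, 1%R]%classic : set (measurableTypeR R)).

Lemma cheb2_W_moment (a b : nat) :
  (mu \x mu)%E.-integrable (square R) (fun x => (cheb2 (a, b) x * W x)%:E) /\
    (\int[mu \x mu]_(x in square R) (cheb2 (a, b) x * W x)%:E =
   ((a == 0) && (b == 0))%:R%:E)%E.
Proof.
have [Ia Ea] := cheb_arcsine_moment a; have [Ib Eb] := cheb_arcsine_moment b.
have mI : measurable itv11 by exact: measurable_itv.
have mS : measurable (square R : set (measurableTypeR R * measurableTypeR R)).
  exact: measurableX.
have Ia' := (integrable_mkcond _ mI).1 Ia; have Ib' := (integrable_mkcond _ mI).1 Ib.
rewrite restrict_EFin in Ia'; rewrite restrict_EFin in Ib'.
have [Iab Eab] := integrable_prod_meas Ia' Ib'.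
have WE : (fun x => (cheb2 (a, b) x * W x)%:E) \_ (square R) =
    (fun z => (pi ^+ 2)^-1%:E * ((cheb_arcsine a \_ itv11) z.1 *
       (cheb_arcsine b \_ itv11) z.2)%:E)%E.
  apply/funext => -[x y]; rewrite !patchE /=.
  have -> : ((x, y) \in square R) = (x \in itv11) && (y \in itv11).
    by apply/idP/andP; rewrite !inE.
  case: (x \in _) => /=; last by rewrite mul0r mule0.
  case: (y \in _) => /=; last by rewrite mulr0 mule0.
  by rewrite -EFinM; congr EFin; rewrite /cheb2 /W /cheb_arcsine /=; ring.
split.
  by apply/(integrable_mkcond _ mS); rewrite WE; exact: integrableZl.
rewrite integral_mkcond WE integralZl // Eab.
have Er c : (\int[mu]_x ((cheb_arcsine c \_ itv11) x)%:E =
    (pi * (c == 0)%:R)%:E)%E.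
  have [_ <-] := cheb_arcsine_moment c; rewrite [RHS]integral_mkcond.
  by apply: eq_integral => x _; rewrite !patchE; case: ifP.
rewrite !Er -!EFinM -mulnb natrM; congr EFin.
have := lt0r_neq0 (pi_gt0 R); move: (@pi R) => p p0.
by field.
Qed.
End chebyshev_moments.

Lemma Pad_sum (R : realType) n (F : R * R -> R) :
  \sum_(x \in Pad R n) F x = \sum_(i in padI n) F (pad_pt R i).
Proof.
rewrite Pad_image fsbig_image; last by move=> i j _ _; exact: pad_pt_inj.
rewrite -(bigfs _ (index_enum_uniq _)) // => i _.
by rewrite mem_index_enum.
Qed.

Lemma Pi2_pred (R : realType) n (P : poly2 R) : Pi2 (2 * n%:Z - 1) P ->
  if n is m.+1 then Pi2 (m + n)%N%:Z P else P = 0.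
Proof.
case: n => [|m].
  by rewrite /Pi2 /= mulr0 subrK lez_nat leqn0 mpoly.msize_poly_eq0 => /eqP.
by congr (Pi2 _ P); lia.
Qed.

(** Integrability is carried along in the induction on the polynomial because
additivity of the integral needs it. *)
Lemma Pad_cubature (R : realType) n (P : poly2 R) : Pi2 (2 * n%:Z - 1) P ->
  (@lebesgue_measure R \x @lebesgue_measure R)%E.-integrable (square R)
    (fun x => (peval P x * W x)%:E) /\
  (\int[@lebesgue_measure R \x @lebesgue_measure R]_(x in square R)
     (peval P x * W x)%:E =
   (\sum_(i in padI n) pad_weight R i * peval P (pad_pt R i))%:E)%E.
Proof.
have mS : measurable (square R : set (measurableTypeR R * measurableTypeR R)).
  by apply: measurableX; exact: measurable_itv.
pose K P := (@lebesgue_measure R \x @lebesgue_measure R)%E.-integrable (square R)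
    (fun x => (peval P x * W x)%:E) /\
  (\int[@lebesgue_measure R \x @lebesgue_measure R]_(x in square R)
     (peval P x * W x)%:E =
   (\sum_(i in padI n) pad_weight R i * peval P (pad_pt R i))%:E)%E.
have K0 : K 0.
  have p0 x : peval (0 : poly2 R) x = 0 by exact: mpoly.meval0.
  split.
    rewrite (_ : (fun x => _) = cst 0%E); first exact: integrable0.
    by apply/funext => x; rewrite p0 mul0r.
  rewrite big1 => [|i _]; last by rewrite p0 mulr0.
  by apply: integral0_eq => x _; rewrite p0 mul0r.
move=> /Pi2_pred; rewrite -/(K P).
case: n @K K0 => [|m] K K0; first by move=> ->.
move: P; apply: (Pi2_ind K0).
- move=> P Q [IP EP] [IQ EQ].
  have E x : ((peval (P + Q) x * W x)%:E =
      (peval P x * W x)%:E + (peval Q x * W x)%:E)%E.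
    by rewrite pevalD mulrDl EFinD.
  split; first by under eq_fun do rewrite E; exact: integrableD.
  under eq_integral do rewrite E; rewrite integralD // EP EQ -EFinD; congr EFin.
  by rewrite -big_split; apply: eq_bigr => i _; rewrite pevalD mulrDr.
- move=> c P [IP EP].
  have E x : ((peval (c *: P) x * W x)%:E = c%:E * (peval P x * W x)%:E)%E.
    by rewrite pevalZ -mulrA EFinM.
  split; first by under eq_fun do rewrite E; exact: integrableZl.
  under eq_integral do rewrite E; rewrite integralZl // EP -EFinM; congr EFin.
  by rewrite mulr_sumr; apply: eq_bigr => i _; rewrite pevalZ mulrCA.
- move=> a b ab; have [IW EW] := @cheb2_W_moment R a b.
  split; first by under eq_fun do rewrite peval_cheb2.
  under eq_integral do rewrite peval_cheb2.
  rewrite EW; congr EFin.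
  under eq_bigr do rewrite peval_cheb2 cheb2_pad_pt.
  rewrite pad_moment; last by lia.
  by have -> : (a == m.+1 + m.+1)%N = false; [lia|rewrite orbF].
Qed.

(* The integral is that of an extended-real valued function; being equal to a
   finite number, it is in particular absolutely convergent. *)
Theorem corollary2p4 (R : realType) (n : nat) :
  unisolvent n (Pad R n) /\
  exists lambda : R * R -> R,
    forall P : poly2 R, Pi2 (2 * n%:Z - 1) P ->
      (\int[@lebesgue_measure R \x @lebesgue_measure R]_(x in square R)
           (peval P x * W x)%:E =
        (\sum_(x \in Pad R n) lambda x * peval P x)%:E)%E.
Proof.
split; first exact: Pad_unisolvent.
(* The sum has a single term when x is a Padua point, and is empty elsewhere. *)
exists (fun x => \sum_(i in padI n | pad_pt R i == x) pad_weight R i) => P.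
move=> /Pad_cubature[_ ->]; rewrite Pad_sum; congr EFin.
apply: eq_bigr => i iA; congr (_ * _).
rewrite (bigD1 i) /=; last by rewrite iA eqxx.
by rewrite big1 ?addr0 // => j /andP[/andP[_ /eqP /pad_pt_inj ->]]; rewrite eqxx.
Qed.
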